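(* Let $n \ge 6$ and let $W_{1,n} = C_n + K_1$ be the wheel graph on $n+1$ vertices. Then $\dim(L(W_{1,n})) = n - \lceil n/3 \rceil$.
   Context: All graphs are finite, simple, undirected and connected. For a graph $H$, a set $W \subseteq V(H)$ is a resolving set if for every pair of distinct vertices $u,v \in V(H)$ there is $x \in W$ with $d(u,x) \ne d(v,x)$, where $d$ denotes the shortest-path distance. The metric dimension $\dim(H)$ is the minimum cardinality of a resolving set of $H$. The line graph $L(G)$ of $G$ has vertex set $E(G)$, two vertices being adjacent iff the corresponding edges of $G$ share an endpoint. $C_n + K_1$ denotes the join of the cycle $C_n$ with a single vertex (the hub), i.e. the hub is adjacent to every vertex of $C_n$. *)

(* Defs.v *)
From mathcomp Require Import all_boot.
Set Implicit Arguments.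
Unset Strict Implicit.
Unset Printing Implicit Defensive.

Record sgraph := SGraph {
  vertex :> finType;
  adj : rel vertex;
  adj_sym : symmetric adj;
  adj_irrefl : irreflexive adj }.

Definition walk_of_length (G : sgraph) (u v : G) (k : nat) : bool :=
  [exists p : k.-tuple G, path (@adj G) u p && (last u p == v)].

(* The least length of a walk from [u] to [v].  Lengths below [#|G|] suffice,
   since a shortest walk repeats no vertex; [dist u v = #|G|] exactly when [u]
   and [v] are not connected. *)
Definition dist (G : sgraph) (u v : G) : nat :=
  find (walk_of_length u v) (iota 0 #|G|).

Definition resolving (G : sgraph) (W : {set G}) : bool :=
  [forall u : G, forall v : G,
    (u != v) ==> [exists x in W, dist u x != dist v x]].

Lemma dist_eq0 (G : sgraph) (u v : G) : (dist u v == 0) = (u == v).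
Proof.
rewrite /dist; case En: #|G| => [|n] /=.
  by have := fintype0 u En.
rewrite -[u == v]andTb; case: ifP => [/existsP[p]|/negbT/existsPn/(_ [tuple])//=].
  by rewrite tuple0 /= => ->.
by move/negbTE ->.
Qed.

Lemma resolving_setT (G : sgraph) : resolving [set: G].
Proof.
apply/forallP=> u; apply/forallP=> v; apply/implyP=> neq_uv.
apply/existsP; exists u; rewrite inE /=.
have /eqP-> : dist u u == 0 by rewrite dist_eq0.
by apply/contraNN: neq_uv => /eqP d0; rewrite eq_sym -dist_eq0 -d0.
Qed.

(* By [resolving_setT] the default [setT] of the arg min is admissible, so this
   is the minimum cardinality of a resolving set. *)
Definition metric_dim (G : sgraph) : nat :=
  #|[arg min_(W < [set: G] | resolving W) #|W| ]|.

Definition edges (G : sgraph) : {set {set G}} :=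
  [set e : {set G} | [exists x : G, exists y : G, adj x y && (e == [set x; y])]].

Section LineGraph.
Variable G : sgraph.

Definition line_vertex : finType := {e : {set G} | e \in edges G}.

Definition line_adj : rel line_vertex :=
  [rel e f | (e != f) && (val e :&: val f != set0)].

Lemma line_adj_sym : symmetric line_adj.
Proof. by move=> e f; rewrite /line_adj /= eq_sym setIC. Qed.

Lemma line_adj_irrefl : irreflexive line_adj.
Proof. by move=> e; rewrite /line_adj /= eqxx. Qed.

Definition line_graph : sgraph := SGraph line_adj_sym line_adj_irrefl.

End LineGraph.

Section Cycle.
Variable n : nat.

(* [ordS i] is [i + 1] modulo [n]; the conjunct [i != j] only matters for
   [n = 1]. *)
Definition cycle_adj : rel 'I_n :=
  [rel i j | (i != j) && ((j == ordS i) || (i == ordS j))].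

Lemma cycle_adj_sym : symmetric cycle_adj.
Proof. by move=> i j; rewrite /cycle_adj /= eq_sym orbC. Qed.

Lemma cycle_adj_irrefl : irreflexive cycle_adj.
Proof. by move=> i; rewrite /cycle_adj /= eqxx. Qed.

Definition cycle_graph : sgraph := SGraph cycle_adj_sym cycle_adj_irrefl.

End Cycle.

Section Complete.
Variable n : nat.

Definition complete_adj : rel 'I_n := [rel i j | i != j].

Lemma complete_adj_sym : symmetric complete_adj.
Proof. by move=> i j; rewrite /complete_adj /= eq_sym. Qed.

Lemma complete_adj_irrefl : irreflexive complete_adj.
Proof. by move=> i; rewrite /complete_adj /= eqxx. Qed.

Definition complete_graph : sgraph :=
  SGraph complete_adj_sym complete_adj_irrefl.

End Complete.

Section Join.
Variables G H : sgraph.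

Definition join_adj : rel (G + H)%type := fun x y =>
  match x, y with
  | inl a, inl b => adj a b
  | inr a, inr b => adj a b
  | _, _ => true
  end.

Lemma join_adj_sym : symmetric join_adj.
Proof. by move=> [a|a] [b|b] //=; apply: adj_sym. Qed.

Lemma join_adj_irrefl : irreflexive join_adj.
Proof. by move=> [a|a] /=; apply: adj_irrefl. Qed.

Definition join_graph : sgraph := SGraph join_adj_sym join_adj_irrefl.

End Join.

Definition wheel (n : nat) : sgraph :=
  join_graph (cycle_graph n) (complete_graph 1).

(* Main.v *)
(* Let a set of wheel edges consist of spokes [S] and rim edges [R].  Two spokes
   are at distance 1, and a spoke is at distance at most 2 from every rim edge,
   so two spokes outside [S] are resolved only by a rim edge of [R] meeting
   exactly one of them.  Hence in a resolving set at most one cycle vertex is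
   untouched, and no rim edge forms on its own a component of the chosen edges.
   A component of [R] on [m] cycle vertices then costs at least [2m/3] elements,
   with equality for paths on three vertices, and [2(n-1)/3] is a lower bound.
   It is reached by covering the cycle with such paths, leaving one vertex
   untouched if [n] is 1 modulo 3, and adding one isolated spoke as well if [n]
   is 2 modulo 3.  Adjacency separates almost all pairs; a rim edge close to the
   gap is told from a spoke by a rim edge at distance 3. *)
Require Import Defs.
From mathcomp Require Import all_boot all_order all_algebra.
From mathcomp Require Import zify.
Import GRing.Theory Num.Theory.
Set Implicit Arguments.
Unset Strict Implicit.
Unset Printing Implicit Defensive.

(** * Distances at most 2 in terms of adjacency *)

Section Distance.
Variable G : sgraph.
Implicit Types u v : G.

Lemma walk0 u v : walk_of_length u v 0 = (u == v).
Proof.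
apply/existsP/eqP => [[p]|<-]; first by rewrite tuple0 /= => /eqP.
by exists [tuple]; rewrite /= eqxx.
Qed.

Lemma walk1 u v : walk_of_length u v 1 = adj u v.
Proof.
apply/existsP/idP => [[p]|uv].
  by case/tupleP: p => w p; rewrite tuple0 /= andbT => /andP[+ /eqP <-].
by exists [tuple v]; rewrite /= uv eqxx.
Qed.

Lemma walk2 u v : walk_of_length u v 2 = [exists w, adj u w && adj w v].
Proof.
apply/existsP/existsP => [[p]|[w /andP[uw wv]]].
  case/tupleP: p => w p; case/tupleP: p => x p; rewrite tuple0 /= andbT.
  by case/andP=> uwx /eqP <-; exists w.
by exists [tuple w; v]; rewrite /= uw wv eqxx.
Qed.

(** Without any walk [dist] defaults to [#|G|]; only below that value does a bound on it yield a
    walk. *)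
Lemma dist_leP u v k : (k < #|G|)%N ->
  reflect (exists2 j, (j <= k)%N & walk_of_length u v j) (dist u v <= k)%N.
Proof.
move=> ltkG; apply: (iffP idP) => [le_dk|[j lejk uvj]].
  have lt_dG := leq_ltn_trans le_dk ltkG; exists (dist u v) => //.
  have has_uv : has (walk_of_length u v) (iota 0 #|G|).
    by rewrite has_find size_iota.
  by have := nth_find 0 has_uv; rewrite nth_iota.
rewrite leqNgt; apply/negP => lt_kd.
have := before_find 0 (leq_ltn_trans lejk lt_kd).
by rewrite nth_iota ?uvj // (leq_ltn_trans lejk).
Qed.

Lemma dist_eq1 u v : (1 < #|G|)%N -> (dist u v == 1%N) = adj u v.
Proof.
move=> lt1G; case: (eqVneq u v) => [<-|neq_uv].
  by rewrite adj_irrefl; have /eqP-> : dist u u == 0 by rewrite dist_eq0.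
rewrite eqn_leq lt0n dist_eq0 neq_uv andbT -walk1.
apply/(dist_leP u v lt1G)/idP => [[[|[|//]] _ //]|uv]; last by exists 1%N.
by rewrite walk0 (negbTE neq_uv).
Qed.

Lemma dist_le2 u v : (2 < #|G|)%N ->
  (dist u v <= 2)%N = [|| u == v, adj u v | [exists w, adj u w && adj w v]].
Proof.
move=> lt2G; rewrite -walk0 -walk1 -walk2.
apply/(dist_leP u v lt2G)/or3P => [[[|[|[|//]]] _ ?]|].
- by constructor 1.
- by constructor 2.
- by constructor 3.
by case=> [?|?|?]; [exists 0%N|exists 1%N|exists 2%N].
Qed.

Lemma adj_dist_neq u v w :
  (1 < #|G|)%N -> adj u w != adj v w -> dist u w != dist v w.
Proof. by move=> lt1G; rewrite -!dist_eq1 //; apply: contraNneq => ->. Qed.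

End Distance.

Lemma setI2_neq0 (T : finType) (a b c d : T) :
  ([set a; b] :&: [set c; d] != set0) = [|| a == c, a == d, b == c | b == d].
Proof.
apply/set0Pn/or4P => [[x]|]; last first.
  by case=> /eqP ?; [exists a|exists a|exists b|exists b]; subst;
    rewrite !inE eqxx ?orbT.
rewrite !inE => /andP[/orP[]/eqP-> /orP[]/eqP->]; rewrite eqxx;
  [by constructor 1|by constructor 2|by constructor 3|by constructor 4].
Qed.

(** * Spokes and rim edges as the vertices of the line graph *)

Section WheelLine.
Variable n : nat.
Hypothesis ge6n : (6 <= n)%N.

(** Trades the modulus for a case split on the wrap-around, a form that [lia] decides. *)
Lemma eq_ordS (i j : 'I_n) : (j == ordS i) =
  ((j == i.+1 :> nat) || ((i.+1 == n) && (j == 0 :> nat)))%N.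
Proof.
rewrite -val_eqE /=; have := ltn_ord i; have := ltn_ord j.
have [lt_in|lt_ni|eq_in] := ltngtP i.+1 n => *.
- by rewrite modn_small // andFb orbF.
- lia.
by have -> : (i.+1 %% n = 0)%N; [rewrite eq_in modnn|lia].
Qed.

Lemma ordS_neq (i : 'I_n) : ordS i != i.
Proof. by rewrite eq_sym eq_ordS; lia. Qed.

Lemma spoke_edge (i : 'I_n) :
  [set inl i; inr ord0] \in edges (wheel n).
Proof.
rewrite inE; apply/existsP; exists (inl i); apply/existsP; exists (inr ord0).
by rewrite eqxx.
Qed.

Lemma rim_edge (i : 'I_n) : [set inl i; inl (ordS i)] \in edges (wheel n).
Proof.
rewrite inE; apply/existsP; exists (inl i); apply/existsP; exists (inl (ordS i)).
rewrite eqxx andbT /= /cycle_adj /= eqxx andbT eq_ordS; lia.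
Qed.

Definition spoke (i : 'I_n) : line_graph (wheel n) := 
  exist (fun e => e \in edges (wheel n)) _ (spoke_edge i).
Definition rim (i : 'I_n) : line_graph (wheel n) := 
  exist (fun e => e \in edges (wheel n)) _ (rim_edge i).

Lemma line_wheelP (x : line_graph (wheel n)) :
  (exists i, x = spoke i) \/ (exists i, x = rim i).
Proof.
case: x => e e_edge; have := e_edge; rewrite inE.
case/existsP=> -[a|a] /existsP[[b|b]] /andP[]; rewrite ?(ord1 a) ?(ord1 b).
- case/andP=> _ /orP[] /eqP-> /eqP e_eq; right; [exists a|exists b].
    exact: val_inj.
  by apply: val_inj; rewrite /= e_eq setUC.
- by move=> _ /eqP e_eq; left; exists a; apply: val_inj.
- by move=> _ /eqP e_eq; left; exists b; apply: val_inj; rewrite /= e_eq setUC.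
by [].
Qed.

Lemma spoke_inj : injective spoke.
Proof.
move=> i j /(congr1 val)/= /setP/(_ (inl i)).
by rewrite !inE eqxx /= orbF => /esym/eqP[].
Qed.

(** Equal rim edges with different indices would have their ends swapped, which happens only on a
    cycle of length 2. *)
Lemma rim_inj : injective rim.
Proof.
move=> i j /(congr1 val)/= /setP eqij; apply/eqP/negPn/negP => neq_ij.
have := eqij (inl i); have := eqij (inl (ordS i)).
rewrite !inE !eqxx /= orbT !(inj_eq inl_inj) (inj_eq (@ordS_inj n)).
rewrite (negbTE neq_ij) [ordS i == _]eq_sym !eq_ordS orbF /= => /esym + /esym.
by move: neq_ij; rewrite -val_eqE /=; lia.
Qed.

Lemma spoke_rim i j : spoke i != rim j.
Proof.
apply/negP => /eqP /(congr1 val)/= /setP/(_ (inr ord0)).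
by rewrite !inE eqxx.
Qed.

Lemma adj_spoke (i j : 'I_n) : adj (spoke i) (spoke j) = (i != j).
Proof.
rewrite /= /line_adj /= setI2_neq0 (inj_eq spoke_inj).
by rewrite eqxx !orbT andbT.
Qed.

Lemma adj_spoke_rim (i j : 'I_n) :
  adj (spoke i) (rim j) = (j == i) || (j == ord_pred i).
Proof.
rewrite /= /line_adj /= setI2_neq0 /= !(inj_eq inl_inj) orbF spoke_rim /=.
by rewrite -(can2_eq (@ordSK n) (@ord_predK n)) ![_ == i]eq_sym.
Qed.

Lemma adj_rim (i j : 'I_n) :
  adj (rim i) (rim j) = (j == ordS i) || (i == ordS j).
Proof.
rewrite /= /line_adj /= setI2_neq0 (inj_eq rim_inj) !(inj_eq inl_inj).
rewrite (inj_eq (@ordS_inj n)) [ordS i == j]eq_sym !eq_ordS -val_eqE /=.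
by have := ltn_ord i; have := ltn_ord j; lia.
Qed.

Lemma card_line_wheel : (2 < #|line_graph (wheel n)|)%N.
Proof. by apply: leq_trans (leq_card _ spoke_inj); rewrite card_ord; lia. Qed.

Lemma dist_spoke_rim_le2 i j : (dist (spoke i) (rim j) <= 2)%N.
Proof.
rewrite dist_le2 ?card_line_wheel // (negbTE (spoke_rim i j)) adj_spoke_rim.
case: eqVneq => [//|neq_ji]; apply/or3P; constructor 3; apply/existsP.
by exists (spoke j); rewrite adj_spoke eq_sym neq_ji adj_spoke_rim eqxx.
Qed.

(** * Lower bound by counting tokens *)

Section LowerBound.
Variable W : {set line_graph (wheel n)}.
Hypothesis resW : resolving W.

Let S := [set i | spoke i \in W].
Let R := [set i | rim i \in W].

Lemma spoke_resolved i j : i \notin S -> j \notin S ->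
  {in R, forall k, adj (spoke i) (rim k) = adj (spoke j) (rim k)} -> i = j.
Proof.
have lt1 := ltnW card_line_wheel; rewrite !inE => iS jS eqR.
apply/eqP/negPn/negP => neq_ij.
have := forallP (forallP resW (spoke i)) (spoke j).
rewrite (inj_eq spoke_inj) neq_ij => /exists_inP[x xW]; apply/negP/negPn.
have [[k Dx]|[k Dx]] := line_wheelP x; subst x.
  have [neq_ik neq_jk] : i != k /\ j != k.
    by split; apply/eqP => eqk; subst k; rewrite xW in iS jS.
  suff dist1 l : l != k -> dist (spoke l) (spoke k) = 1%N by rewrite !dist1.
  by move=> neq_lk; apply/eqP; rewrite dist_eq1 // adj_spoke.
have {eqR} := eqR k; rewrite inE => /(_ xW).
rewrite -(dist_eq1 (spoke i) _ lt1) -(dist_eq1 (spoke j) _ lt1).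
have := dist_spoke_rim_le2 i k; have := dist_spoke_rim_le2 j k.
have := dist_eq0 (spoke i) (rim k); have := dist_eq0 (spoke j) (rim k).
by rewrite !(negbTE (spoke_rim _ _)); lia.
Qed.

(* Each element of [W] carries three tokens: a spoke gives them all to its end
   on the cycle, the [i]-th rim edge gives [share i] to [i] and the rest to
   [ordS i]. *)
Let share i : nat :=
  if (ordS i \in S) || (i \notin S) && (ord_pred i \notin R) then 2 else 1.
Let tokens i : nat :=
  (i \in S) * 3 + (i \in R) * share i
    + (ord_pred i \in R) * (3 - share (ord_pred i)).
Let covered := [set i | [|| i \in S, i \in R | ord_pred i \in R]].

(** A spoke at [i] brings 3 tokens and two rim edges at least 1 each. If [rim i] alone covers [i],
    the second clause of [share] grants 2. The remaining case, [rim (ord_pred i)] alone, uses that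
    [W] is resolving. *)
Lemma covered_tokens i : i \in covered -> (2 <= tokens i)%N.
Proof.
rewrite inE /tokens; case: (boolP (i \in S)) => [|iS]; first by lia.
have share12 j : (1 <= share j <= 2)%N by rewrite /share; case: ifP.
case: (boolP (ord_pred i \in R)) => [pR|pR]; last first.
  by rewrite orbF => /= iR; rewrite iR /share iS pR orbT.
move=> _; have := share12 i; have := share12 (ord_pred i).
case: (boolP (i \in R)) => [|iR]; first by lia.
(* A share of 2 would make this rim edge a component by itself, and no edge of [R] would then
   separate the spokes at its two ends. *)
suff -> : share (ord_pred i) = 1%N by lia.
rewrite /share ord_predK (negbTE iS) /=; case: ifP => // /andP[pS ppR].
have /eqP := ordS_neq (ord_pred i); rewrite ord_predK; case.
apply: spoke_resolved => // k kR; rewrite !adj_spoke_rim.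
have [/negbTE-> /negbTE->] : k != i /\ k != ord_pred (ord_pred i).
  by split; [apply: contraNneq iR|apply: contraNneq ppR] => <-.
by rewrite orbF.
Qed.

Lemma card_uncovered : (#|~: covered| <= 1)%N.
Proof.
have uncoveredP l : l \in ~: covered ->
    [/\ l \notin S, l \notin R & ord_pred l \notin R].
  by rewrite in_setC in_set !negb_or => /and3P.
apply/card_le1_eqP => i j /uncoveredP[iS iR piR] /uncoveredP[jS jR pjR].
apply: spoke_resolved => // k kR; rewrite !adj_spoke_rim.
have neqR l : l \notin R -> (k == l) = false.
  by move=> lR; apply/eqP => eq_kl; rewrite -eq_kl kR in lR.
by rewrite !neqR.
Qed.

Lemma sum_tokens : \sum_i tokens i = ((#|S| + #|R|) * 3)%N.
Proof.
have sum_card (A : {set 'I_n}) : (\sum_i (i \in A) = #|A|)%N.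
  by rewrite -sum1_card [RHS]big_mkcond; apply: eq_bigr => i _; case: (i \in A).
rewrite !big_split /= -big_distrl /= sum_card mulnDl -addnA; congr (_ + _)%N.
(* Shifting the index along the cycle brings the two parts given out by one rim edge together, and
   they add up to 3. *)
have <- : \sum_i (i \in R) * (3 - share i) =
          \sum_i (ord_pred i \in R) * (3 - share (ord_pred i)).
  exact: reindex_inj (@ord_pred_inj n).
rewrite -big_split /= -sum_card big_distrl /=; apply: eq_bigr => i _.
by rewrite /share; case: ifP; case: (i \in R).
Qed.

Lemma resolving_lower : ((n - 1) * 2 <= #|W| * 3)%N.
Proof.
have cardW : (#|S| + #|R| <= #|W|)%N.
  rewrite -(card_imset _ spoke_inj) -(card_imset _ rim_inj) -cardsUI.
  have -> : (spoke @: S) :&: (rim @: R) = set0.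
    apply/setP => x; rewrite !inE; apply/negP.
    case/andP=> /imsetP[i _ ->] /imsetP[j _ /eqP].
    by rewrite (negbTE (spoke_rim i j)).
  rewrite cards0 addn0 subset_leq_card //.
  by apply/subsetP => x; rewrite inE => /orP[]/imsetP[i]; rewrite inE => ? ->.
have card_covered : (n - 1 <= #|covered|)%N.
  by have := cardsC covered; have := card_uncovered; rewrite card_ord; lia.
apply: leq_trans (_ : \sum_i tokens i <= _)%N; last by rewrite sum_tokens; lia.
rewrite (leq_trans (leq_mul card_covered (leqnn 2))) // -sum_nat_const.
rewrite [leqRHS](bigID (fun i => i \in covered)) /=.
apply: leq_trans (leq_addr _ _); apply: leq_sum => i; exact: covered_tokens.
Qed.

End LowerBound.

(** * Upper bound by an explicit resolving set *)

Lemma adj_spoke_rimE (i j : 'I_n) : (j.+1 < n)%N ->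
  adj (spoke i) (rim j) = (i == j :> nat) || (i == j.+1 :> nat).
Proof.
move=> lt_jn; rewrite adj_spoke_rim -(can2_eq (@ordSK n) (@ord_predK n)).
by rewrite [ordS j == i]eq_sym eq_ordS -val_eqE /=; lia.
Qed.

Lemma adj_rimE (i j : 'I_n) : (j.+1 < n)%N ->
  adj (rim i) (rim j) = [|| i == j.+1 :> nat, j == i.+1 :> nat |
                            (i.+1 == n) && (j == 0 :> nat)].
Proof. by move=> lt_jn; rewrite adj_rim !eq_ordS; lia. Qed.

(** The bounds keep the two edges 3 steps apart both ways round the cycle, so no spoke or rim edge
    meets both. *)
Lemma dist_rim_gt2 (i j : 'I_n) :
  (j + 3 <= i)%N -> (i + 3 <= j + n)%N -> (2 < dist (rim i) (rim j))%N.
Proof.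
move=> le_ji le_in; rewrite ltnNge dist_le2 ?card_line_wheel //.
have /negbTE neq_ij : i != j by rewrite -val_eqE /=; lia.
rewrite (inj_eq rim_inj) neq_ij adj_rim !eq_ordS; apply/or3P.
case=> [//||/existsP[x /andP[]]]; first by lia.
have := ltn_ord i; have := ltn_ord j.
have [[k ->]|[k ->]] := line_wheelP x; last first.
  by rewrite !adj_rim !eq_ordS; have := ltn_ord k; lia.
rewrite adj_sym !adj_spoke_rim -!(can2_eq (@ordSK n) (@ord_predK n)).
by rewrite ![ordS _ == k]eq_sym !eq_ordS -!val_eqE /=; have := ltn_ord k; lia.
Qed.

Section UpperBound.

Let t := (n %/ 3)%N.
(** Edges [3q] and [3q+1] form a path on the vertices [3q], [3q+1], [3q+2]. If two vertices are left
    over, [S] takes the spoke at the first of them. *)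
Let R := [set i : 'I_n | (i < t * 3)%N && (i %% 3 != 2)%N].
Let S := [set i : 'I_n | (n %% 3 == 2)%N && (i == t * 3 :> nat)%N].
Let W := (rim @: R) :|: (spoke @: S).

Let separated u v := exists2 x, x \in W & dist u x != dist v x.

Lemma separated_sym u v : separated u v -> separated v u.
Proof. by case=> x xW; rewrite eq_sym; exists x. Qed.

Lemma separated_mem u v : u \in W -> u != v -> separated u v.
Proof.
move=> uW neq_uv; exists u => //; rewrite eq_sym.
have /eqP-> : dist u u == 0 by rewrite dist_eq0.
by rewrite dist_eq0 eq_sym.
Qed.

Lemma rim_mem i : i \in R -> rim i \in W.
Proof. by move=> iR; rewrite inE imset_f. Qed.

(** No edge of [R] closes the cycle, so adjacency to it can be tested by linear arithmetic on
    indices. *)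
Lemma basis_rim m : (m < t * 3)%N -> (m %% 3 != 2)%N ->
  exists i : 'I_n, [/\ i = m :> nat, (i.+1 < n)%N & rim i \in W].
Proof.
move=> lt_m m_mod; have lt_mn : (m < n)%N by lia.
by exists (Ordinal lt_mn); split; [|rewrite /=; lia|rewrite rim_mem // inE lt_m].
Qed.

Lemma separated_spokes_lt (i j : 'I_n) :
  (i < j)%N -> separated (spoke i) (spoke j).
Proof.
move=> lt_ij; have lt_jn := ltn_ord j.
have [/andP[n_mod /eqP Di]|not_spare] :=
  boolP ((n %% 3 == 2) && (i == t * 3 :> nat))%N.
  apply: separated_mem; last by rewrite (inj_eq spoke_inj) -val_eqE /=; lia.
  by rewrite inE orbC imset_f // inE n_mod Di eqxx.
(* It suffices to find a path edge [m] with exactly one of the vertices [i], [j] as an end. *)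
have [m [lt_m m_mod ne_m]] : exists m, [/\ (m < t * 3)%N, (m %% 3 != 2)%N &
    ((i == m :> nat) || (i == m.+1 :> nat))
      != ((j == m :> nat) || (j == m.+1 :> nat))].
  have [lt_j|le_j] := ltnP j (t * 3).
    have [j2|j2] := boolP (j %% 3 == 2)%N; last by exists j; split; lia.
    have [ij|ij] := boolP (i.+1 == j)%N; [exists (j - 2)%N|exists j.-1];
      split; lia.
  (* Now [j] is off the paths and [i], not being the end of the spare spoke, is on one; a path edge
     at [i] misses [j]. *)
  have [i2|i2] := boolP (i %% 3 == 2)%N; [exists i.-1|exists i]; split; lia.
have [l [Dl lt_l lW]] := basis_rim lt_m m_mod; exists (rim l) => //.
by apply: adj_dist_neq (ltnW card_line_wheel) _; rewrite !adj_spoke_rimE // Dl.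
Qed.

Lemma separated_rims (i j : 'I_n) : i != j -> separated (rim i) (rim j).
Proof.
move=> neq_ij; have lt_in := ltn_ord i; have lt_jn := ltn_ord j.
have [iR|iR] := boolP (i \in R).
  by apply: separated_mem (rim_mem iR) _; rewrite (inj_eq rim_inj).
have [jR|jR] := boolP (j \in R).
  apply/separated_sym/separated_mem; first exact: rim_mem.
  by rewrite (inj_eq rim_inj) eq_sym.
have [m [lt_m m_mod ne_m]] : exists m, [/\ (m < t * 3)%N, (m %% 3 != 2)%N &
    [|| i == m.+1 :> nat, m == i.+1 :> nat | (i.+1 == n) && (m == 0 :> nat)]
      != [|| j == m.+1 :> nat, m == j.+1 :> nat |
             (j.+1 == n) && (m == 0 :> nat)]].
  move: iR jR neq_ij; rewrite !inE -val_eqE /= => iR jR neq_ij.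
  (* Here [i] is 2 modulo 3, and edge [i-1] meets only the rim edges [i] and [i-2], the latter in
     [R]. *)
  have [lt_i|le_i] := ltnP i (t * 3); first by exists i.-1; split; lia.
  have [lt_j|le_j] := ltnP j (t * 3); first by exists j.-1; split; lia.
  (* These are the last two rim edges of a cycle with [n = 3t+2]; only the very last meets edge
     0. *)
  by exists 0; split; lia.
have [l [Dl lt_l lW]] := basis_rim lt_m m_mod; exists (rim l) => //.
by apply: adj_dist_neq (ltnW card_line_wheel) _; rewrite !adj_rimE // Dl.
Qed.

Lemma separated_far (i j l : 'I_n) : rim l \in W ->
  (l + 3 <= i)%N -> (i + 3 <= l + n)%N -> separated (rim i) (spoke j).
Proof.
move=> lW le_li le_in; exists (rim l) => //.
have := dist_rim_gt2 le_li le_in.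
by apply: contraTneq => ->; rewrite -leqNgt dist_spoke_rim_le2.
Qed.

Lemma separated_rim_spoke (i j : 'I_n) : separated (rim i) (spoke j).
Proof.
have lt_in := ltn_ord i; have lt_jn := ltn_ord j.
have [iR|] := boolP (i \in R).
  by apply: separated_mem (rim_mem iR) _; rewrite eq_sym spoke_rim.
rewrite inE => iR.
have far m : (m < t * 3)%N -> (m %% 3 != 2)%N -> (m + 3 <= i)%N ->
    (i + 3 <= m + n)%N -> separated (rim i) (spoke j).
  move=> lt_m m_mod le_mi le_in; have [l [Dl _ lW]] := basis_rim lt_m m_mod.
  by apply: (@separated_far _ _ l); rewrite ?Dl.
(* As [t] is at least 2, [i] is at least 6, so edge 3 is far enough in both directions. *)
have [le_i|lt_i] := leqP (t * 3)%N i; first by apply: (far 3); lia.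
(* This edge leaves the last path towards the gap and has the same neighbours in [R] as the spoke at
   [i], so adjacency to [R] cannot suffice. Edge 0 may be too near across the gap; edge 1 is not. *)
have [last_i|inner_i] := boolP ((i.+1 == t * 3) && (t * 3 < n))%N.
  by apply: (far 1); lia.
have [m [lt_m m_mod ne_m]] : exists m, [/\ (m < t * 3)%N, (m %% 3 != 2)%N &
    [|| i == m.+1 :> nat, m == i.+1 :> nat | (i.+1 == n) && (m == 0 :> nat)]
      != ((j == m :> nat) || (j == m.+1 :> nat))].
  (* Now [rim i] links two consecutive paths and meets an edge of each, edge 0 being the second one
     if [i] is the last index. No spoke meets both. *)
  have [j_i|j_i] := boolP ((j == i :> nat) || (j.+1 == i :> nat)); last first.
    by exists i.-1; split; lia.
  by have [iS|iS] := boolP (i.+1 < n)%N; [exists i.+1|exists 0]; split; lia.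
have [l [Dl lt_l lW]] := basis_rim lt_m m_mod; exists (rim l) => //.
apply: adj_dist_neq (ltnW card_line_wheel) _.
by rewrite adj_rimE // adj_spoke_rimE // Dl.
Qed.

Lemma resolving_basis : resolving W.
Proof.
apply/forallP => u; apply/forallP => v; apply/implyP => neq_uv.
suff [x xW neq_d] : separated u v by apply/exists_inP; exists x.
have [[i Du]|[i Du]] := line_wheelP u; have [[j Dv]|[j Dv]] := line_wheelP v;
  subst u v.
- have [ij|ji|/val_inj eq_ij] := ltngtP i j; first exact: separated_spokes_lt.
    exact/separated_sym/separated_spokes_lt.
  by rewrite eq_ij eqxx in neq_uv.
- exact/separated_sym/separated_rim_spoke.
- exact: separated_rim_spoke.
by apply: separated_rims; apply: contraNneq neq_uv => ->.
Qed.

Lemma card_basis : (#|W| <= t * 2 + (n %% 3 == 2))%N.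
Proof.
have := leq_card_setU (rim @: R) (spoke @: S); rewrite -/W.
rewrite (card_imset _ rim_inj) (card_imset _ spoke_inj) => /leq_trans; apply.
apply: leq_add.
  (* This map renumbers [3q] and [3q+1] as [2q] and [2q+1]. *)
  have inj_f : {in enum R &, injective (fun i : 'I_n => (i - i %/ 3)%N)}.
    move=> i j; rewrite !mem_enum !inE => iR jR eq_f; apply: val_inj => /=.
    by lia.
  rewrite cardE -(size_map (fun i : 'I_n => (i - i %/ 3)%N)).
  rewrite -[(t * 2)%N](size_iota 0) uniq_leq_size //.
    by rewrite map_inj_in_uniq ?enum_uniq.
  move=> m /mapP[i]; rewrite mem_enum inE => iR ->.
  by rewrite mem_iota; lia.
case: (boolP (n %% 3 == 2)%N) => n_mod /=.
  apply/card_le1_eqP => i j; rewrite !inE => /andP[_ /eqP ei] /andP[_ /eqP ej].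
  by apply: val_inj; rewrite /= ei ej.
by rewrite leqn0 cards_eq0; apply/eqP/setP => i; rewrite !inE (negbTE n_mod).
Qed.

End UpperBound.

(** For [n] equal to [3t], [3t+1], [3t+2], rounding [2(n-1)/3] up gives [2t], [2t], [2t+1], which is
    the bound on the size of the basis. *)
Lemma metric_dim_line_wheel :
  metric_dim (line_graph (wheel n)) = (n - (n + 2) %/ 3)%N.
Proof.
rewrite /metric_dim; case: arg_minnP => [|W resW minW].
  exact: resolving_setT.
have := minW _ resolving_basis; have := card_basis.
by have := resolving_lower resW; lia.
Qed.

End WheelLine.

Local Open Scope ring_scope.

Theorem theorem2p9 (n : nat) (hn : (6 <= n)%N) :
  (metric_dim (line_graph (wheel n)))%:Z = n%:Z - Num.ceil (n%:Q / 3).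
Proof.
rewrite metric_dim_line_wheel //.
have -> : Num.ceil (n%:Q / 3) = ((n + 2) %/ 3)%N%:Z; last by lia.
apply: ceil_def; rewrite ltr_pdivlMr // ler_pdivrMr //.
by rewrite -[3]/(3%:~R) -!intrM ltr_int ler_int; lia.
Qed.
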